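(* There is a universal constant $c>0$ such that for every variation parameter $v\in[0,1]$ and every accuracy parameter $a\in[0,1]$ there exist problem data $(Q,(b_t),(h_t),\mathcal{D})$ for the Nonstationary Newsvendor with Predictions satisfying the standing assumptions such that for every horizon $T\ge1$ and every policy $\pi$ (which may depend on the knowledge of $v$ and $a$), $$\mathcal{R}^\pi(T)\ge c\,T^{\min\{(3+v)/4,\,a\}}.$$
   Context: **Nonstationary Newsvendor with Predictions.** Problem data: a set $Q\subset\mathbb{R}_{\ge 0}$ bounded above by $Q_{\max}$; known per-unit underage costs $b_t\in[0,b_{\max}]$ and overage costs $h_t\in[0,h_{\max}]$; a known family of distributions $\mathcal{D}=\{\mathcal{D}_\mu:\mu\in[\mu_{\min},\mu_{\max}]\}$ parameterized by its mean, $\mu=\mathbb{E}[\mathcal{D}_\mu]$. Standing assumptions: each $\mathcal{D}_\mu$ is sub-Gaussian (i.e. $X\sim\mathcal{D}_\mu$ satisfies $\mathbb{P}(|X|>x)\le2\exp(-x^2/K^2)$ for all $x\ge 0$, for some $K$); and, with $C(\mu,b,h,q)=\mathbb{E}_{d\sim\mathcal{D}_\mu}[b(d-q)^++h(q-d)^+]$ ($x^+=\max\{0,x\}$), there is $\ell$ with $|C(\mu_1,b,h,q)-C(\mu_2,b,h,q)|\le\ell|\mu_1-\mu_2|$ for all $\mu_1,\mu_2\in[\mu_{\min},\mu_{\max}]$, $b\in[0,b_{\max}]$, $h\in[0,h_{\max}]$, $q\in Q$. Write $C_t(\mu,q)=C(\mu,b_t,h_t,q)$; argmins over $Q$ are assumed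 nonempty. In each period $t=1,\dots,T$ the decision-maker receives a (deterministic) prediction $a_t$, selects $q_t\in Q$, then $d_t$ is drawn from an unknown $D_t=\mathcal{D}_{\mu_t}\in\mathcal{D}$ (independently over time) and observed. A policy $\pi=(\pi_1,\dots,\pi_T)$ is a sequence of mappings, $\pi_t$ taking $d_1,\dots,d_{t-1}$ and $a_1,\dots,a_t$ to $q_t\in Q$. Demand variation of $\bm{\mu}=(\mu_1,\dots,\mu_T)$: $V_{\bm\mu}=\max\sum_{k=1}^K|\mu_{t_k}-\mu_{t_{k-1}}|^2$, the maximum being over $0\le K\le T-1$ and all $1\le t_0<\dots<t_K\le T$. $\mathcal{D}(v)=\{(D_1,\dots,D_T): D_t\in\mathcal{D}\ \forall t,\ V_{\bm\mu}\le T^v\}$. Accuracy parameter $a$: the predictions satisfy $\sum_{t=1}^T|a_t-\mu_t|\le T^a$. With $q_t^*\in\arg\min_{q\in Q}C_t(\mu_t,q)$, the worst-case regret is $$\mathcal{R}^\pi(T)=\sup\ \mathbb{E}^\pi\Big[\sum_{t=1}^T\big(C_t(\mu_t,q_t)-C_t(\mu_t,q_t^* )\big)\Big],$$ the supremum being over $\bm D\in\mathcal{D}(v)$ and prediction sequences with $\sum_{t=1}^T|a_t-\mu_t|\le T^a$. *)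

(* Defs.v *)
(* MathComp-Analysis *)
From HB Require Import structures.
From mathcomp Require Import all_boot all_order all_algebra.
From mathcomp Require Import all_classical all_reals all_analysis.
Import Order.TTheory GRing.Theory Num.Theory.
Import numFieldNormedType.Exports.

Set Implicit Arguments.
Unset Strict Implicit.
Unset Printing Implicit Defensive.

Local Open Scope classical_set_scope.
Local Open Scope ring_scope.

Section product_law.
Context (R : realType).

Definition tuple_cons n (x : R * n.-tuple R) : n.+1.-tuple R :=
  [tuple of x.1 :: x.2].

Lemma measurable_tuple_cons n : measurable_fun setT (@tuple_cons n).
Proof. exact: measurable_cons. Qed.

HB.instance Definition _ n :=
  isMeasurableFun.Build _ _ _ _ (@tuple_cons n) (@measurable_tuple_cons n).

(* The product measure P 0 \x ... \x P (n-1) on n.-tuple R, i.e. the joint law of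
   independent X_i distributed as P i; see product_law_box. *)
Fixpoint product_law n :
    ('I_n -> probability R R) -> probability (n.-tuple R) R :=
  match n return ('I_n -> probability R R) -> probability (n.-tuple R) R with
  | 0 => fun=> dirac [tuple]
  | n'.+1 => fun P =>
      distribution (P ord0 \x product_law (fun i => P (lift ord0 i)))%E
                   (@tuple_cons n')
  end.

Lemma product_law_box n (P : 'I_n -> probability R R) (A : 'I_n -> set R) :
  (forall i, measurable (A i)) ->
  (product_law P [set x | forall i, A i (tnth x i)] = \prod_(i < n) P i (A i))%E.
Proof.
elim: n => [|n IHn] in P A * => mA.
  by rewrite big_ord0 /= diracE mem_set//= => -[].
rewrite big_ord_recl -IHn//= /distribution /pushforward /=.
rewrite -product_measure1E//; last first.
  have -> : [set x : n.-tuple R | forall i, A (lift ord0 i) (tnth x i)] =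
      \bigcap_(i in [set: 'I_n]) ((fun x => tnth x i) @^-1` A (lift ord0 i)).
    by apply/seteqP; split => x /= Ax i; [move=> _|]; exact: Ax.
  apply: fin_bigcap_measurable => // i _.
  by rewrite -[X in measurable X]setTI; exact: measurable_tnth.
congr (_ _); apply/seteqP; split => -[x y] /=.
  move=> Axy; split => [|i]; first exact: (Axy ord0).
  by have := Axy (lift ord0 i); rewrite tnthS.
move=> [Ax Ay] i; case: (unliftP ord0 i) => [j|] ->; last exact: Ax.
by rewrite tnthS; exact: Ay.
Qed.

End product_law.

Record newsvendor (R : realType) := Newsvendor {
  order_quantities : set R;
  order_max : R;
  underage : nat -> R;
  underage_max : R;
  overage : nat -> R;
  overage_max : R;
  (* Only the values of demand_law on [mean_min, mean_max] are relevant. *)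
  demand_law : R -> probability R R;
  mean_min : R;
  mean_max : R }.

Section newsvendor_theory.
Context (R : realType).
Implicit Types (I : newsvendor R) (mu b h q : R).

(* The expectation is finite, so that fine loses nothing, as soon as the demand
   law is sub-Gaussian. *)
Definition cost I mu b h q : R :=
  fine 'E_(demand_law I mu)[fun d => b * Num.max 0 (d - q) +
                                     h * Num.max 0 (q - d)].

(* Periods are numbered from 0. *)
Definition period_cost I (t : nat) mu q : R :=
  cost I mu (underage I t) (overage I t) q.

Definition argmin (Q : set R) (f : R -> R) : set R :=
  [set q | Q q /\ forall q', Q q' -> f q <= f q'].

Definition sub_gaussian (P : probability R R) : Prop :=
  exists2 K : R, 0 < K & forall x : R, 0 <= x ->
    (P [set y : R | (x < `|y|)%R] <= (2 * expR (- (x ^+ 2 / K ^+ 2)))%:E)%E.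

Record standing_assumptions I : Prop := StandingAssumptions {
  order_quantities_bounds : forall q, order_quantities I q -> 0 <= q <= order_max I;
  underage_bounds : forall t, 0 <= underage I t <= underage_max I;
  overage_bounds : forall t, 0 <= overage I t <= overage_max I;
  mean_bounds : mean_min I <= mean_max I;
  demand_mean : forall mu, mean_min I <= mu <= mean_max I ->
    ('E_(demand_law I mu)[id] = mu%:E)%E;
  demand_sub_gaussian : forall mu, mean_min I <= mu <= mean_max I ->
    sub_gaussian (demand_law I mu);
  cost_lipschitz : exists l : R, forall mu1 mu2 b h q,
    mean_min I <= mu1 <= mean_max I -> mean_min I <= mu2 <= mean_max I ->
    0 <= b <= underage_max I -> 0 <= h <= overage_max I -> order_quantities I q ->
    `|cost I mu1 b h q - cost I mu2 b h q| <= l * `|mu1 - mu2|;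
  argmin_nonempty : forall t mu, mean_min I <= mu <= mean_max I ->
    argmin (order_quantities I) (period_cost I t mu) !=set0 }.

(* Some minimizer q_t^*; under argmin_nonempty the default value is not used. *)
Definition optimal_order I (t : nat) mu : R :=
  xget 0 (argmin (order_quantities I) (period_cost I t mu)).

Definition first_terms T n (le_nT : (n <= T)%N) (x : 'I_T -> R) : n.-tuple R :=
  [tuple x (widen_ord le_nT i) | i < n].

(* The order of period t depends on the t demands of the earlier periods and on
   the t.+1 predictions received so far. It is measurable in the demands, so
   that the expected regret makes sense; since predictions are deterministic,
   nothing is required of the dependence on them. *)
Record policy (Q : set R) (T : nat) := Policy {
  order_rule :> forall t : 'I_T, t.-tuple R -> t.+1.-tuple R -> R;
  order_rule_in : forall t d p, Q (@order_rule t d p);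
  measurable_order_rule : forall t p,
    measurable_fun setT (fun d => @order_rule t d p) }.

Arguments order_rule {Q T} _ t _ _.

Definition order_at Q T (pi : policy Q T) (p : 'I_T -> R) (d : T.-tuple R)
    (t : 'I_T) : R :=
  pi t (first_terms (ltnW (ltn_ord t)) (tnth d)) (first_terms (ltn_ord t) p).

(* The maximum of \sum_k |mu_(t_k) - mu_(t_(k-1))|^2 over 0 <= K <= T - 1 and
   t_0 < ... < t_K; the default value 0 is attained by K = 0. *)
Definition demand_variation T (mu : 'I_T -> R) : R :=
  \big[Num.max/0]_(K < T)
  \big[Num.max/0]_(t : {ffun 'I_K.+1 -> 'I_T} |
      [forall i : 'I_K.+1, forall j : 'I_K.+1, (i < j)%N ==> (t i < t j)%N])
  \sum_(k < K) `|mu (t (lift ord0 k)) - mu (t (widen_ord (leqnSn K) k))| ^+ 2.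

(* The sequences of laws in D(v), represented by their means. *)
Definition demand_means I T (v : R) : set ('I_T -> R) :=
  [set mu | (forall t, mean_min I <= mu t <= mean_max I) /\
            demand_variation mu <= T%:R `^ v].

Definition accurate_predictions T (a : R) (mu : 'I_T -> R) : set ('I_T -> R) :=
  [set p | \sum_(t < T) `|p t - mu t| <= T%:R `^ a].

Definition expected_regret I T (pi : policy (order_quantities I) T)
    (mu p : 'I_T -> R) : \bar R :=
  'E_(product_law (fun t => demand_law I (mu t)))[fun d =>
    \sum_(t < T) (period_cost I t (mu t) (order_at pi p d t) -
                  period_cost I t (mu t) (optimal_order I t (mu t)))].

Definition worst_case_regret I (v a : R) T (pi : policy (order_quantities I) T)
    : \bar R :=
  ereal_sup [set r | exists mu p : 'I_T -> R, [/\ demand_means I v mu,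
    accurate_predictions a mu p & r = expected_regret pi mu p]].

End newsvendor_theory.

(* Main.v *)
Require Import Defs.
From HB Require Import structures.
From mathcomp Require Import all_boot all_order all_algebra.
From mathcomp Require Import all_classical all_reals all_analysis.
From mathcomp Require Import measurable_realfun ring lra.
Import Order.TTheory GRing.Theory Num.Theory.
Import numFieldNormedType.Exports.

Set Implicit Arguments.
Unset Strict Implicit.
Unset Printing Implicit Defensive.

Local Open Scope classical_set_scope.
Local Open Scope ring_scope.

(** One instance serves for all [v] and [a]: Bernoulli demand with mean [m] in
    [[0, 1]], orders in [{0, 1}], unit underage and overage costs. Ordering [0]
    costs [m] and ordering [1] costs [1 - m], so when [m] is [1/2 + d] or
    [1/2 - d] a wrong order costs exactly [2 * d]: the regret is linear in the
    distance to the indifference point, although two such means are only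
    [O(d ^ 2)] apart as statistical hypotheses.

    The adversary cuts the horizon into batches of length [D] and picks in each
    batch a sign for the deviation [d] of the mean from [1/2], while every
    prediction is [1/2]. Three constraints bound [d] and [D]:
    - at most [T / D] sign changes, each contributing [4 * d ^ 2] to the demand
      variation, must fit in [T ^ v];
    - the total prediction error [T * d] must be at most [T ^ a];
    - [d ^ 2 * D] must be bounded, so that a whole batch of observations does not
      reveal its sign.
    With [D] close to [T ^ ((1 - v) / 2)] the first and the third constraints both
    say that [d] is at most of order [T ^ (- (1 - v) / 4)], and [T * d] can be made
    of order [T ^ min ((3 + v) / 4, a)] ([hard_instance_rates]).

    The third constraint gives the lower bound by Le Cam's method: for fixed
    signs in the other batches, the two laws of the demands obtained by flipping
    the sign of one batch overlap so much that any decision errs with total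
    probability at least [1/4] ([bernoulli_two_point]). Averaging over all sign
    vectors produces signs for which the expected number of wrong orders is at
    least [T / 8] ([exists_hard_signs]), hence an expected regret of at least
    [d * T / 4]. *)

(** * The Bernoulli newsvendor *)

Section bernoulli_newsvendor.
Context (R : realType).
Implicit Types (m q : R) (f : R -> R).

Definition bool_demand (b : bool) : R := b%:R.

Lemma measurable_bool_demand : measurable_fun setT bool_demand.
Proof. by []. Qed.

HB.instance Definition _ :=
  isMeasurableFun.Build _ _ _ _ bool_demand measurable_bool_demand.

Definition bernoulli_law m : probability R R :=
  distribution (bernoulli_prob m) bool_demand.

Lemma bernoulli_lawE m (A : set R) : 0 <= m <= 1 ->
  bernoulli_law m A = (m * \1_A 1 + (1 - m) * \1_A 0)%:E.
Proof.
by move=> m01; rewrite /= /distribution /pushforward /= bernoulli_probE.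
Qed.

Lemma expectation_bernoulli_law m f : 0 <= m <= 1 -> measurable_fun setT f ->
  ('E_(bernoulli_law m)[f] = (m * f 1 + (1 - m) * f 0)%:E)%E.
Proof.
move=> m01 mf; rewrite expectation.unlock integralE.
have ge0E (g : R -> R) : measurable_fun setT g -> (forall x, 0 <= g x) ->
    (\int[bernoulli_law m]_x (g x)%:E = (m * g 1 + (1 - m) * g 0)%:E)%E.
  move=> mg g0; rewrite ge0_integral_distribution//=; last first.
    exact/measurable_EFinP.
  apply: etrans (integral_bernoulli_prob m01
    (f := fun b => (g (bool_demand b))%:E) _) _ => //.
  by move=> b; rewrite lee_fin.
have -> : (EFin \o f)^\+%E = EFin \o (fun x => Num.max (f x) 0).
  by apply/funext => x; rewrite /= funeposE EFin_max.
have -> : (EFin \o f)^\-%E = EFin \o (fun x => Num.max (- f x) 0).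
  by apply/funext => x; rewrite /= funenegE EFin_max.
rewrite !ge0E//=.
- rewrite -EFinB; congr EFin.
  have maxB (x : R) : Num.max x 0 - Num.max (- x) 0 = x.
    by case: (lerP x 0); case: (lerP (- x) 0); lra.
  by rewrite -[in RHS](maxB (f 1)) -[in RHS](maxB (f 0)); ring.
- by apply: measurable_maxr => //; apply: measurableT_comp.
- by move=> x; rewrite le_max lexx orbT.
- by apply: measurable_maxr.
- by move=> x; rewrite le_max lexx orbT.
Qed.

Definition bernoulli_newsvendor : newsvendor R := {|
  order_quantities := [set 0; 1];
  order_max := 1;
  underage := cst 1;
  underage_max := 1;
  overage := cst 1;
  overage_max := 1;
  demand_law := bernoulli_law;
  mean_min := 0;
  mean_max := 1 |}.

Local Notation I := bernoulli_newsvendor.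

Lemma bernoulli_cost0 m b h : 0 <= m <= 1 -> cost I m b h 0 = b * m.
Proof.
move=> m01; rewrite /cost /= expectation_bernoulli_law//=; last first.
  apply: measurable_funD; apply: measurable_funM => //;
  by apply: measurable_maxr => //; apply: measurable_funB.
rewrite !subr0 sub0r maxxx (max_r (@ler01 R)) (max_l (lerN10 R)).
by ring.
Qed.

Lemma bernoulli_cost1 m b h : 0 <= m <= 1 -> cost I m b h 1 = h * (1 - m).
Proof.
move=> m01; rewrite /cost /= expectation_bernoulli_law//=; last first.
  apply: measurable_funD; apply: measurable_funM => //;
  by apply: measurable_maxr => //; apply: measurable_funB.
rewrite !subr0 subrr sub0r maxxx (max_r (@ler01 R)) (max_l (lerN10 R)).
by ring.
Qed.

(** The tail is at most [1] below [1] and vanishes from [1] on, so any scale [K]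
    with [2 * exp (- K ^- 2) >= 1] works; [K = 2] does, by
    [exp (- 1/4) >= 3/4]. *)
Lemma bernoulli_sub_gaussian m : 0 <= m <= 1 -> sub_gaussian (bernoulli_law m).
Proof.
move=> m01; exists 2 => // x x0; rewrite bernoulli_lawE// lee_fin !indicE.
rewrite [(0 : R) \in _]memNset /= ?normr0; last by apply/negP; rewrite -leNgt.
have [x1|x1] := ltP x 1; last first.
  rewrite memNset /= ?normr1; last by apply/negP; rewrite -leNgt.
  by rewrite !mulr0 addr0 mulr_ge0// expR_ge0.
rewrite mulr0 addr0 (le_trans (y := 1))//.
  by case: (_ \in _); rewrite ?mulr0 ?mulr1//; case/andP: m01.
apply: le_trans (ler_wpM2l _ (expR_ge1Dx _)) => //.
have : x ^+ 2 <= 1 by rewrite expr_le1// ltW.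
by lra.
Qed.

Lemma bernoulli_standing_assumptions : standing_assumptions I.
Proof.
split => /=.
- by move=> q [] ->; rewrite ?lexx ?ler01.
- by move=> t; rewrite ler01 lexx.
- by move=> t; rewrite ler01 lexx.
- exact: ler01.
- move=> m m01; rewrite expectation_bernoulli_law//=.
  by rewrite mulr1 mulr0 addr0.
- exact: bernoulli_sub_gaussian.
- exists 1 => m1 m2 b h q m1P m2P /andP[b0 b1] /andP[h0 h1] [] ->.
    rewrite !bernoulli_cost0// -mulrBr normrM (ger0_norm b0).
    by rewrite ler_wpM2r.
  rewrite !bernoulli_cost1// -mulrBr normrM (ger0_norm h0).
  rewrite (_ : 1 - m1 - (1 - m2) = m2 - m1); last by ring.
  by rewrite (distrC m2) ler_wpM2r.
- move=> t m m01.
  have [m2|m2] := leP m 2^-1.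
    exists 0; split => /=; first by left.
    move=> q [] ->; rewrite /period_cost ?bernoulli_cost0 ?bernoulli_cost1//=.
    by rewrite !mul1r; lra.
  exists 1; split => /=; first by right.
  move=> q [] ->; rewrite /period_cost ?bernoulli_cost0 ?bernoulli_cost1//=.
  by rewrite !mul1r; lra.
Qed.

Lemma bernoulli_period_regret (t : nat) (s : bool) (d q : R) : 0 <= d <= 2^-1 ->
  order_quantities I q ->
  let m := if s then 2^-1 + d else 2^-1 - d in
  period_cost I t m q - period_cost I t m (optimal_order I t m) =
  2 * d * (if s then 1 - q else q).
Proof.
move=> /andP[d0 d2] Qq m.
have m01 : 0 <= m <= 1 by rewrite /m; case: ifP => _; apply/andP; split; lra.
have [x [Qx xmin]] := argmin_nonempty bernoulli_standing_assumptions t m01.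
have [] : argmin (order_quantities I) (period_cost I t m) (optimal_order I t m).
  by apply: xgetPex; exists x.
set opt := optimal_order _ _ _ => Qopt opt_min.
(* For d = 0 both orders are optimal, so the optimal order is not determined by
   the sign; comparing its cost with both orders covers this case too. *)
have := opt_min 0 (or_introl erefl); have := opt_min 1 (or_intror erefl).
case: Qopt Qq => -> [] ->;
  rewrite /period_cost ?bernoulli_cost0 ?bernoulli_cost1//=;
  rewrite /m; case: ifP => _; lra.
Qed.

End bernoulli_newsvendor.

(** * Atoms of product laws *)

Section product_law_atoms.
Context (R : realType) (n : nat) (K : finType) (e : K -> R).

Definition atom (x : {ffun 'I_n -> K}) : n.-tuple R := [tuple e (x i) | i < n].

Lemma product_law_atom (P : 'I_n -> probability R R) (x : {ffun 'I_n -> K}) :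
  (product_law P [set atom x] = \prod_(i < n) P i [set e (x i)])%E.
Proof.
rewrite -product_law_box//; congr (product_law P _).
apply/seteqP; split => y /=; first by move=> -> i; rewrite tnth_mktuple.
by move=> yx; apply/eq_from_tnth => i; rewrite yx tnth_mktuple.
Qed.

Lemma measurable_atom (x : {ffun 'I_n -> K}) : measurable [set atom x].
Proof.
have -> : [set atom x] =
    \bigcap_(i in [set: 'I_n]) ((fun y => tnth y i) @^-1` [set e (x i)]).
  apply/seteqP; split => y /=; first by move=> -> i _ /=; rewrite tnth_mktuple.
  by move=> yx; apply/eq_from_tnth => i; rewrite (yx i) ?tnth_mktuple.
apply: fin_bigcap_measurable => // i _.
by rewrite -[X in measurable X]setTI; exact: measurable_tnth.
Qed.

(** Restricting the integral of a nonnegative function to finitely many atoms can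
    only decrease it. For Bernoulli factors it is an equality, but the inequality is all
    that a lower bound needs, and it turns the expected regret into a finite
    sum. *)
Lemma expectation_product_law_ge (P : 'I_n -> probability R R)
    (w : 'I_n -> K -> R) (f : n.-tuple R -> R) :
  injective e -> (forall i k, P i [set e k] = (w i k)%:E) ->
  measurable_fun setT f -> (forall y, 0 <= f y) ->
  ((\sum_(x : {ffun 'I_n -> K}) (\prod_i w i (x i)) * f (atom x))%:E <=
   'E_(product_law P)[f])%E.
Proof.
move=> e_inj Pw mf f0; rewrite expectation.unlock.
have mfE (D : set (n.-tuple R)) : measurable_fun D (EFin \o f).
  exact/measurable_funTS/measurable_EFinP.
have atom_inj : injective atom.
  move=> x y /(congr1 (fun z => tnth z)) xy; apply/ffunP => i; apply: e_inj.
  by move/(congr1 (@^~ i)): xy; rewrite !tnth_mktuple.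
pose S := \big[setU/set0]_(x : {ffun 'I_n -> K}) [set atom x].
have mS : measurable S.
  by apply: bigsetU_measurable => x _; exact: measurable_atom.
apply: (@le_trans _ _ (\int[product_law P]_(y in S) (f y)%:E)%E); last first.
  by apply: ge0_subset_integral => // y _; rewrite lee_fin.
rewrite /S ge0_integral_bigsetU//=.
- rewrite -sumEFin; apply: lee_sum => x _.
  rewrite (eq_integral (cst (f (atom x))%:E)); last first.
    by move=> y; rewrite inE => ->.
  rewrite integral_cst; last exact: measurable_atom.
  rewrite mulrC EFinM -prodEFin -(eq_bigr _ (fun i _ => Pw i (x i))).
  by rewrite -product_law_atom.
- exact: measurable_atom.
- exact: index_enum_uniq.
- by move=> x y _ _ [z [/= -> /atom_inj]].
- by move=> y _; rewrite lee_fin.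
Qed.

End product_law_atoms.

(** * Finite averages and products *)

Section averaging.
Context (R : realType).

Lemma exists_ge_average (X : finType) (F : X -> R) (c : R) (x0 : X) :
  c *+ #|X| <= \sum_x F x -> exists x, c <= F x.
Proof.
move=> cF; apply: contrapT => /forallNP Fc.
have : \sum_x F x < \sum_(x : X) c.
  apply: ltr_sum => [|x _]; last by rewrite ltNge; apply/negP/Fc.
  by apply/hasP; exists x0; rewrite ?mem_index_enum.
by rewrite sumr_const ltNge cF.
Qed.

Lemma sum_involution_ge (X : finType) (F : X -> R) (phi : X -> X) (c : R) :
  involutive phi -> (forall x, c *+ 2 <= F x + F (phi x)) ->
  c *+ #|X| <= \sum_x F x.
Proof.
move=> phiK cF; rewrite -sumr_const -(@ler_pMn2r _ 2)// -sumrMnl.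
rewrite [leRHS]mulr2n [X in _ + X](reindex_inj (inv_inj phiK)) -big_split /=.
by apply: ler_sum => x _; exact: cF.
Qed.

Lemma prod_onem_ge (X : finType) (a : X -> R) : (forall i, 0 <= a i <= 1) ->
  1 - \sum_i a i <= \prod_i (1 - a i).
Proof.
move=> a01; suff /and3P[] : [&& 1 - \sum_i a i <= \prod_i (1 - a i),
  0 <= \prod_i (1 - a i) & \prod_i (1 - a i) <= 1] by [].
elim/big_rec2: _ => [|i p s _ /and3P[sp p0 p1]].
  by rewrite subr0 lexx ler01.
by have /andP[] := a01 i => ai0 ai1; apply/and3P; split; nra.
Qed.

End averaging.

(** * Le Cam's two-point method *)

Section two_point_testing.
Context (R : realType).

(** The right-hand side is at least [min p q], and
    [min p q >= p * q / (p + q) >= s ^ 2 / (p + q) >= s - (p + q) / 4], the last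
    step by the inequality between arithmetic and geometric means. Being linear in
    [p + q], the bound survives summation over all outcomes. *)
Lemma le_cam_pointwise (p q s u : R) : 0 <= p -> 0 <= q -> s ^+ 2 <= p * q ->
  0 <= u <= 1 -> s - (p + q) / 4 <= p * u + q * (1 - u).
Proof.
have below (x y : R) : 0 <= x -> 0 <= y -> s ^+ 2 <= x * y ->
    s <= x + (x + y) / 4.
  move=> x0 y0 sxy; rewrite leNgt; apply/negP => ss.
  have : (x + (x + y) / 4) ^+ 2 < s ^+ 2 by rewrite ltr_sqr ?nnegrE//; lra.
  rewrite ltNge => /negP; apply; apply: le_trans sxy _.
  have := sqr_ge0 (5 * x - y); nra.
move=> p0 q0 spq /andP[u0 u1].
have sp := below _ _ p0 q0 spq.
have sq : s <= q + (q + p) / 4 by apply: below => //; rewrite mulrC.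
nra.
Qed.

(** The product of the [g i] minorizes the geometric mean of the two product
    laws; both its total mass and that of the laws factor over the coordinates.
    Taking any minorant of the geometric mean, instead of the mean itself, leaves
    room for one that is free of square roots. *)
Lemma le_cam_product (n : nat) (K : finType) (w w' g : 'I_n -> K -> R)
    (u : {ffun 'I_n -> K} -> R) :
  (forall i k, 0 <= w i k) -> (forall i k, 0 <= w' i k) ->
  (forall i, \sum_k w i k = 1) -> (forall i, \sum_k w' i k = 1) ->
  (forall i k, g i k ^+ 2 <= w i k * w' i k) ->
  (forall x, 0 <= u x <= 1) ->
  \prod_i \sum_k g i k - 2^-1 <=
    \sum_(x : {ffun 'I_n -> K}) (\prod_i w i (x i)) * u x +
    \sum_(x : {ffun 'I_n -> K}) (\prod_i w' i (x i)) * (1 - u x).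
Proof.
move=> w0 w'0 w1 w'1 gw u01.
have mass1 (v : 'I_n -> K -> R) : (forall i, \sum_k v i k = 1) ->
    \sum_(x : {ffun 'I_n -> K}) \prod_i v i (x i) = 1.
  by move=> v1; rewrite -bigA_distr_bigA big1.
have -> : 2^-1 = (\sum_(x : {ffun 'I_n -> K}) \prod_i w i (x i) +
    \sum_(x : {ffun 'I_n -> K}) \prod_i w' i (x i)) / 4 :> R.
  by rewrite !mass1//; lra.
rewrite bigA_distr_bigA -!big_split /= mulr_suml -sumrB; apply: ler_sum => x _.
apply: le_cam_pointwise => //; [exact: prodr_ge0|exact: prodr_ge0|].
rewrite -prodrXl -big_split /=; apply: ler_prod => i _.
by rewrite sqr_ge0 gw.
Qed.

Definition coin_expectation n (m : 'I_n -> R) (f : {ffun 'I_n -> bool} -> R) : R :=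
  \sum_(x : {ffun 'I_n -> bool}) (\prod_i bernoulli_pmf (m i) (x i)) * f x.

Lemma sum_bernoulli_pmf (m : R) : \sum_b bernoulli_pmf m b = 1.
Proof. by rewrite big_bool /bernoulli_pmf /=; ring. Qed.

(** Reflecting [#|S|] coins of bias [d] multiplies the overlap (the sum of the
    geometric means) by [sqrt (1 - 4 * d ^ 2)] for each of them. This is at least
    [1 - 4 * d ^ 2], so the overlap is at least [1 - 4 * d ^ 2 * #|S| >= 3/4]. *)
Lemma bernoulli_two_point (n : nat) (S : {pred 'I_n}) (m m' : 'I_n -> R) (d : R)
    (u : {ffun 'I_n -> bool} -> R) :
  (forall i, 0 <= m i <= 1) ->
  (forall i, m' i = if i \in S then 1 - m i else m i) ->
  (forall i, i \in S -> (m i - 2^-1) ^+ 2 = d ^+ 2) ->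
  4 * d ^+ 2 * #|S|%:R <= 4^-1 ->
  (forall x, 0 <= u x <= 1) ->
  4^-1 <= coin_expectation m u + coin_expectation m' (fun x => 1 - u x).
Proof.
move=> m01 m'E md dS u01.
have m'01 i : 0 <= m' i <= 1.
  by rewrite m'E; case: ifP => _ //; have /andP[] := m01 i; lra.
pose h i := if i \in S then 4 * (m i - 2^-1) ^+ 2 else 0.
have h01 i : 0 <= h i <= 1.
  rewrite /h; case: ifP => _; last by rewrite lexx ler01.
  have /andP[mi0 mi1] := m01 i; apply/andP; split; last by nra.
  by rewrite mulr_ge0// sqr_ge0.
pose g i b := if i \in S then (1 - h i) / 2 else bernoulli_pmf (m i) b.
apply: (@le_trans _ _ (\prod_i \sum_(b : bool) g i b - 2^-1)); last first.
  apply: (le_cam_product (w := fun i => bernoulli_pmf (m i))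
    (w' := fun i => bernoulli_pmf (m' i)) (g := g)).
  - by move=> i k; exact: bernoulli_pmf_ge0.
  - by move=> i k; exact: bernoulli_pmf_ge0.
  - by move=> i; exact: sum_bernoulli_pmf.
  - by move=> i; exact: sum_bernoulli_pmf.
  - move=> i b; rewrite /g m'E; have := h01 i; rewrite /h; case: ifP => _.
      move=> /andP[hi0 hi1].
      have -> : bernoulli_pmf (m i) b * bernoulli_pmf (1 - m i) b =
          (1 - 4 * (m i - 2^-1) ^+ 2) / 4.
        by rewrite /bernoulli_pmf; case: b => /=; field.
      by nra.
    by move=> _; rewrite expr2.
  - exact: u01.
have -> : \prod_i \sum_(b : bool) g i b = \prod_i (1 - h i).
  apply: eq_bigr => i _; rewrite /g /h; case: ifP => _.
    by rewrite big_bool /=; field.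
  by rewrite sum_bernoulli_pmf subr0.
have hsum : \sum_i h i = 4 * d ^+ 2 * #|S|%:R.
  rewrite /h -big_mkcond /= (eq_bigr (fun=> 4 * d ^+ 2)) => [|i iS].
    by rewrite sumr_const mulr_natr.
  by rewrite md.
have := prod_onem_ge h01; rewrite hsum; lra.
Qed.

End two_point_testing.

(** * Mean sequences that are constant on batches *)

(** A potential [B] that dominates every squared jump telescopes along any
    subsequence. *)
Lemma demand_variation_le (R : realType) T (mu B : 'I_T -> R) (M : R) : 0 <= M ->
  (forall s t : 'I_T, (s < t)%N -> `|mu t - mu s| ^+ 2 <= B t - B s) ->
  (forall t, 0 <= B t <= M) -> demand_variation mu <= M.
Proof.
move=> M0 muB BM; apply/bigmax_leP; split=> // K _; apply/bigmax_leP; split=> //.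
move=> /= t /forallP t_incr.
pose G k := B (t (inord k)).
apply: (@le_trans _ _ (\sum_(k < K) (G k.+1 - G k))).
  apply: ler_sum => k _; rewrite /G.
  have -> : inord k.+1 = lift ord0 k :> 'I_K.+1.
    by apply/val_inj; rewrite /= inordK// ltnS.
  have -> : inord k = widen_ord (leqnSn K) k :> 'I_K.+1.
    by apply/val_inj; rewrite /= inordK// ltnS ltnW.
  apply: muB; move: (t_incr (widen_ord (leqnSn K) k)) => /forallP.
  by move=> /(_ (lift ord0 k)) /implyP; apply.
rewrite -(big_mkord xpredT (fun k => G k.+1 - G k)) telescope_sumr//.
have /andP[_ GK] := BM (t (inord K)); have /andP[G0 _] := BM (t (inord 0)).
by rewrite (le_trans _ GK)// gerBl.
Qed.

Section batches.
Context (R : realType) (T D : nat).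
Implicit Types (d : R) (t k : 'I_T) (sg : {ffun 'I_T -> bool}).

(** There are at most [T] batches, so indexing them by ['I_T] is harmless: the
    signs beyond the last batch are dummies, and averages over sign vectors are
    unaffected by them. *)
Definition batch t : 'I_T := Ordinal (leq_ltn_trans (leq_div t D) (ltn_ord t)).

Lemma card_batch k : (0 < D)%N -> (#|[pred t | batch t == k]| <= D)%N.
Proof.
move=> D_gt0; rewrite -[leqRHS]card_ord.
pose f t := Ordinal (ltn_pmod t D_gt0).
rewrite -(@card_in_image _ _ f) ?max_card// => s t.
rewrite !inE => /eqP sk /eqP tk /(congr1 val) /= st; apply/val_inj => /=.
move: sk; rewrite -tk => /(congr1 val) /= st'.
by rewrite (divn_eq s D) (divn_eq t D) st st'.
Qed.

Definition batch_means d sg t : R :=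
  if sg (batch t) then 2^-1 + d else 2^-1 - d.

Lemma batch_means_dist d sg t : 0 <= d -> `|2^-1 - batch_means d sg t| = d.
Proof.
move=> d0; rewrite /batch_means; case: ifP => _.
  by rewrite opprD addrA subrr sub0r normrN ger0_norm.
by rewrite opprB addrCA subrr addr0 ger0_norm.
Qed.

Lemma batch_means_variation d sg : (0 < D)%N -> 0 <= d ->
  demand_variation (batch_means d sg) <= 4 * d ^+ 2 * (T%:R / D%:R).
Proof.
move=> D_gt0 d0; have c0 : 0 <= 4 * d ^+ 2 :> R by rewrite mulr_ge0 ?sqr_ge0.
apply: (@demand_variation_le _ _ _ (fun t => 4 * d ^+ 2 * (t %/ D)%:R)).
- by rewrite mulr_ge0// divr_ge0.
- move=> s t st; rewrite -mulrBr -natrB ?leq_div2r//; last exact: ltnW.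
  have [eq_st|ne_st] := eqVneq (batch s) (batch t).
    by rewrite /batch_means eq_st subrr normr0 expr0n mulr_ge0.
  have lt_st : (s %/ D < t %/ D)%N.
    by rewrite ltn_neqAle leq_div2r ?(ltnW st)// andbT.
  apply: (@le_trans _ _ (4 * d ^+ 2)); last first.
    by rewrite ler_peMr// ler1n subn_gt0.
  rewrite real_normK ?num_real// /batch_means.
  by case: ifP => _; case: ifP => _; nra.
- move=> t; rewrite mulr_ge0//= ler_wpM2l// ler_pdivlMr ?ltr0n// -natrM ler_nat.
  by rewrite (leq_trans (leq_divM _ _))// ltnW.
Qed.

Definition flip_at k sg : {ffun 'I_T -> bool} :=
  [ffun j => if j == k then ~~ sg j else sg j].

Lemma flip_atK k : involutive (flip_at k).
Proof.
by move=> sg; apply/ffunP => j; rewrite !ffunE; case: eqP; rewrite ?negbK.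
Qed.

(** In a batch with sign [true] the right order is [1], so the loss of an order
    [q] is [1 - q]; with sign [false] it is [q]. *)
Definition sign_loss sg t (q : R) : R := if sg (batch t) then 1 - q else q.

Lemma flip_at_mistake d t (u : {ffun 'I_T -> bool} -> R) sg :
  (0 < D)%N -> 0 <= d <= 2^-1 -> 4 * d ^+ 2 * D%:R <= 4^-1 ->
  (forall x, 0 <= u x <= 1) ->
  4^-1 <= coin_expectation (batch_means d sg) (fun x => sign_loss sg t (u x)) +
    coin_expectation (batch_means d (flip_at (batch t) sg))
      (fun x => sign_loss (flip_at (batch t) sg) t (u x)).
Proof.
move=> D_gt0 /andP[d0 d2] dD u01.
have step s (v : {ffun 'I_T -> bool} -> R) : (forall x, 0 <= v x <= 1) ->
    4^-1 <= coin_expectation (batch_means d s) v +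
      coin_expectation (batch_means d (flip_at (batch t) s)) (fun x => 1 - v x).
  apply: (bernoulli_two_point (S := [pred i | batch i == batch t]) (d := d)).
  - by move=> i; rewrite /batch_means; case: ifP => _; apply/andP; split; lra.
  - move=> i; rewrite !inE /batch_means ffunE.
    by case: eqP => // _; case: (s _) => /=; lra.
  - by move=> i _; rewrite /batch_means; case: ifP => _; ring.
  - apply: le_trans dD; rewrite ler_wpM2l ?mulr_ge0 ?sqr_ge0//.
    by rewrite ler_nat card_batch.
rewrite /sign_loss [flip_at _ sg _]ffunE eqxx.
case: (sg (batch t)) => /=; last exact: step.
have -> : (fun x => u x) = (fun x => 1 - (1 - u x)).
  by apply/funext => x; rewrite subKr.
apply: (step sg (fun x => 1 - u x)) => x.
by have /andP[] := u01 x; rewrite subr_ge0 gerBl => -> ->.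
Qed.

(** Each period is handled by its own pairing of the sign vectors, namely by
    flipping the sign of its batch; the average over all sign vectors is common to
    all periods, so one sign vector is bad on the whole horizon. *)
Lemma exists_hard_signs d (u : 'I_T -> {ffun 'I_T -> bool} -> R) :
  (0 < D)%N -> 0 <= d <= 2^-1 -> 4 * d ^+ 2 * D%:R <= 4^-1 ->
  (forall t x, 0 <= u t x <= 1) ->
  exists sg, 8^-1 *+ T <= \sum_t
    coin_expectation (batch_means d sg) (fun x => sign_loss sg t (u t x)).
Proof.
move=> D_gt0 d2 dD u01; apply: (exists_ge_average [ffun=> true]).
set N := #|_|; have -> : 8^-1 *+ T *+ N = \sum_(t < T) 8^-1 *+ N :> R.
  by rewrite sumr_const card_ord mulrnAC.
rewrite exchange_big /=; apply: ler_sum => t _.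
apply: (sum_involution_ge (flip_atK (batch t))) => sg.
apply: le_trans (flip_at_mistake t sg D_gt0 d2 dD (u01 t)).
by rewrite -mulr_natr; lra.
Qed.

End batches.

(** * Expected regret of a policy *)

Section expected_regret.
Context (R : realType).
Local Notation I := (bernoulli_newsvendor R).

Lemma measurable_first_terms n T (le_nT : (n <= T)%N) :
  measurable_fun setT (fun d : T.-tuple R => first_terms le_nT (tnth d)).
Proof.
apply/measurable_fun_tnthP => i /=.
rewrite (_ : _ \o _ = (fun d : T.-tuple R => tnth d (widen_ord le_nT i))).
  exact: measurable_tnth.
by apply/funext => d /=; rewrite tnth_mktuple.
Qed.

Lemma measurable_order_at Q T (pi : policy Q T) (p : 'I_T -> R) t :
  measurable_fun setT (fun d => order_at pi p d t).
Proof.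
have mrule : measurable_fun setT (fun d => pi t d (first_terms (ltn_ord t) p)).
  exact: measurable_order_rule.
exact: measurableT_comp mrule (measurable_first_terms _).
Qed.

Lemma expected_regret_ge T D (pi : policy (order_quantities I) T)
    (p : 'I_T -> R) (d : R) (sg : {ffun 'I_T -> bool}) : 0 <= d <= 2^-1 ->
  ((2 * d * \sum_t coin_expectation (batch_means D d sg)
      (fun x => sign_loss D sg t (order_at pi p (atom (@bool_demand R) x) t)))%:E
   <= expected_regret pi (batch_means D d sg) p)%E.
Proof.
move=> d2; have /andP[d0 d2'] := d2.
pose mu := batch_means D d sg.
have mu01 t : 0 <= mu t <= 1.
  by rewrite /mu /batch_means; case: ifP => _; apply/andP; split; lra.
pose f (y : T.-tuple R) :=
  \sum_t 2 * d * sign_loss D sg t (order_at pi p y t).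
rewrite /expected_regret.
have -> : (fun y : T.-tuple R => \sum_(t < T)
    (period_cost I t (mu t) (order_at pi p y t) -
     period_cost I t (mu t) (optimal_order I t (mu t)))) = f.
  apply/funext => y; apply: eq_bigr => t _.
  by rewrite bernoulli_period_regret//; exact: order_rule_in.
apply: (@le_trans _ _ (\sum_(x : {ffun 'I_T -> bool})
    (\prod_i bernoulli_pmf (mu i) (x i)) * f (atom (@bool_demand R) x))%:E).
  rewrite lee_fin mulr_sumr /coin_expectation.
  under eq_bigr do rewrite mulr_sumr.
  rewrite exchange_big /=; apply: ler_sum => x _; rewrite mulr_sumr.
  by apply: ler_sum => t _; rewrite mulrCA.
apply: (expectation_product_law_ge (w := fun i => bernoulli_pmf (mu i)) (f := f)).
- by move=> [] [] // /eqP; rewrite /bool_demand ?oner_eq0 1?eq_sym ?oner_eq0.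
- move=> i k; rewrite bernoulli_lawE// !indicE /bernoulli_pmf /bool_demand.
  have in1 (x y : R) : (x \in [set y]) = (x == y) by apply/idP/eqP; rewrite inE.
  rewrite !in1; case: k; rewrite /= eqxx.
    by rewrite (eq_sym 0) oner_eq0 mulr1 mulr0 addr0.
  by rewrite oner_eq0 mulr1 mulr0 add0r.
- apply: measurable_sum => t; apply: measurable_funM => //; rewrite /sign_loss.
  case: (sg (batch D t)); last exact: measurable_order_at.
  by apply: measurable_funB => //; exact: measurable_order_at.
- move=> y; apply: sumr_ge0 => t _; apply: mulr_ge0; first by rewrite mulr_ge0.
  have : order_quantities I (order_at pi p y t) by exact: order_rule_in.
  by rewrite /sign_loss => -[] ->; case: ifP => _; rewrite ?subr0 ?subrr ?ler01.
Qed.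

End expected_regret.

(** * The lower bound *)

(** Rounding [T ^ ((1 - v) / 2)] to an integer at most doubles it, and the factor
    [1/8] in [d] pays for this doubling in the second bound:
    [4 * 2 / 64 <= 1/4]. *)
Lemma hard_instance_rates (R : realType) (v a : R) (T : nat) :
  0 <= v <= 1 -> 0 <= a <= 1 -> (1 <= T)%N ->
  let x : R := T%:R in
  let d := x `^ (Num.min ((3 + v) / 4) a - 1) / 8 in
  let D := (Num.truncn (x `^ ((1 - v) / 2))).+1 in
  [/\ 0 <= d <= 2^-1, 4 * d ^+ 2 * D%:R <= 4^-1,
      4 * d ^+ 2 * (x / D%:R) <= x `^ v & x * d <= x `^ a].
Proof.
move=> /andP[v0 v1] /andP[a0 a1] T1 x d D.
set e := Num.min _ _ in d *.
have x1 : 1 <= x by rewrite ler1n.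
have x0 : 0 < x by exact: lt_le_trans x1.
have xneq0 : x != 0 by rewrite gt_eqF.
have powR_ge1 r : 0 <= r -> 1 <= x `^ r.
  by move=> /(ler_powR x1); rewrite powRr0.
have powR_le1 r : r <= 0 -> x `^ r <= 1.
  by move=> /(ler_powR x1); rewrite powRr0.
have e_v : e <= (3 + v) / 4 by rewrite ge_min lexx.
have e_a : e <= a by rewrite ge_min lexx orbT.
pose y := x `^ ((1 - v) / 2).
have y0 : 0 < y by exact: powR_gt0.
have y1 : 1 <= y by apply: powR_ge1; lra.
have yD : y <= D%:R by apply/ltW/truncnS_gt.
have Dy : D%:R <= 2 * y.
  have := truncn_le y; rewrite (ltW y0) /D -natr1 -/y; lra.
have D0 : 0 < D%:R :> R by rewrite ltr0n.
have pow_d : 0 < x `^ (e - 1) by exact: powR_gt0.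
have d2E : d ^+ 2 = x `^ (2 * (e - 1)) / 64.
  rewrite /d expr_div_n -powR_mulrn ?powR_ge0// -powRrM (mulrC _ 2).
  by congr (_ / _); ring.
have d2y : d ^+ 2 * y <= 64^-1.
  rewrite d2E mulrAC ler_pdivrMr// mulVf// -powRD ?xneq0 ?implybT//.
  by apply: powR_le1; lra.
have d2 := sqr_ge0 d.
split.
- apply/andP; split; first by rewrite /d; lra.
  have : x `^ (e - 1) <= 1 by apply: powR_le1; lra.
  by rewrite /d; lra.
- by nra.
- rewrite mulrA ler_pdivrMr//; apply: (@le_trans _ _ (x `^ v * y)); last first.
    by rewrite ler_wpM2l ?powR_ge0.
  have xE : x `^ (2 * (e - 1)) * x = x `^ (2 * (e - 1) + 1).
    by rewrite powRD ?xneq0 ?implybT// powRr1// ltW.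
  have : x `^ (2 * (e - 1)) * x <= x `^ v * y.
    by rewrite xE /y -powRD ?xneq0 ?implybT// ler_powR//; lra.
  have : 0 <= x `^ (2 * (e - 1)) * x by rewrite xE powR_ge0.
  by rewrite d2E; lra.
- rewrite /d mulrA; have -> : x * x `^ (e - 1) = x `^ e.
    by rewrite -{1}(powRr1 (ltW x0)) -powRD ?xneq0 ?implybT// subrKC.
  have := ler_powR x1 e_a; have := powR_ge0 x e; lra.
Qed.

Theorem proposition2 (R : realType) :
  exists2 c : R, 0 < c &
  forall v a : R, 0 <= v <= 1 -> 0 <= a <= 1 ->
  exists2 I : newsvendor R, standing_assumptions I &
  forall T : nat, (1 <= T)%N -> forall pi : policy (order_quantities I) T,
  ((c * T%:R `^ (Num.min ((3 + v) / 4) a))%:E <= worst_case_regret v a pi)%E.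
Proof.
(* A wrong order costs 2 * d with d = T ^ (e - 1) / 8, and T / 8 wrong orders are
   expected: 2 / 8 / 8 = 1 / 32. *)
exists 32^-1; first by rewrite invr_gt0.
move=> v a v01 a01; exists (bernoulli_newsvendor R).
  exact: bernoulli_standing_assumptions.
move=> T T1 pi; have := hard_instance_rates v01 a01 T1; cbv zeta.
set e := Num.min _ _; set d := T%:R `^ _ / 8; set D := (Num.truncn _).+1.
move=> [d2 dD var_le acc_le].
have /andP[d0 _] := d2.
pose p : 'I_T -> R := fun=> 2^-1.
pose u t x := order_at pi p (atom (@bool_demand R) x) t.
have u01 t x : 0 <= u t x <= 1.
  have : order_quantities (bernoulli_newsvendor R) (u t x).
    exact: order_rule_in.
  by move=> [] ->; rewrite ?lexx ?ler01.
have [sg sgP] := exists_hard_signs (isT : (0 < D)%N) d2 dD u01.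
apply: (@le_trans _ _ (expected_regret pi (batch_means D d sg) p)); last first.
  apply: ereal_sup_ubound; exists (batch_means D d sg), p; split => //.
  - split => [t|]; last exact: le_trans (batch_means_variation _ _ _) var_le.
    by rewrite /batch_means; case: ifP => _; apply/andP; split => /=; lra.
  - rewrite /accurate_predictions /= (eq_bigr (fun=> d)) => [|t _].
      by rewrite sumr_const card_ord -[leLHS]mulr_natl.
    by rewrite batch_means_dist.
apply: le_trans (expected_regret_ge _ _ _ _ d2) => //.
rewrite lee_fin; apply: le_trans (ler_wpM2l _ sgP); last by rewrite mulr_ge0.
have T0 : 0 < T%:R :> R by rewrite ltr0n.
have -> : T%:R `^ e = T%:R * (8 * d) :> R.
  have -> : 8 * d = T%:R `^ (e - 1) by rewrite /d; lra.
  by rewrite -{2}(powRr1 (ltW T0)) -powRD ?subrKC// (gt_eqF T0) implybT.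
by rewrite -mulr_natr; lra.
Qed.
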